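(* Let $n \geq 8$ be an integer, let $m = \lfloor n/8 \rfloor$ and $\bar r = n \bmod 8$. Then the mixed domination number of the generalized Petersen graph $P(n,1)$ is $$\gamma_{md}(P(n,1)) = \begin{cases} 6m & \text{if } \bar r = 0,\\ 6m+2 & \text{if } \bar r \in \{1,2\},\\ 6m+3 & \text{if } \bar r = 3,\\ 6m+4 & \text{if } \bar r \in \{4,5\},\\ 6m+5 & \text{if } \bar r = 6,\\ 6m+6 & \text{if } \bar r = 7.\end{cases}$$
   Context: For integers $n$ and $k$ with $1 \le k \le n/2$, the generalized Petersen graph $P(n,k)$ has vertex set $\{v_i, u_i : 0 \le i \le n-1\}$ and edge set $\{v_i v_{(i+1) \bmod n},\ v_i u_i,\ u_i u_{(i+k) \bmod n} : 0 \le i \le n-1\}$. For a graph $G=(V,E)$, a set $S \subseteq V \cup E$ is a mixed dominating set if every element of $(V \cup E)\setminus S$ is adjacent or incident to some element of $S$ (vertices are adjacent if joined by an edge, edges are adjacent if they share an endpoint, and a vertex and an edge are incident if the vertex is an endpoint of the edge). The mixed domination number $\gamma_{md}(G)$ is the minimum size of a mixed dominating set of $G$. *)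

(* Defs.v *)
From mathcomp Require Import all_boot.

Set Implicit Arguments.
Unset Strict Implicit.
Unset Printing Implicit Defensive.

(* A finite simple graph on [T] is given by its edge set, each edge being the
   two-element set of its endpoints. *)
Definition simple_edges (T : finType) (E : {set {set T}}) : Prop :=
  forall A, A \in E -> #|A| = 2.

Section MixedDomination.
Variables (T : finType) (E : {set {set T}}).

(* [inl x] is the vertex x and [inr A] the edge A; terms [inr A] with
   [A \notin E] do not belong to the graph. *)
Definition elements : {set T + {set T}} :=
  [set z | match z with inl _ => true | inr A => A \in E end].

Definition adj_or_inc (z w : T + {set T}) : bool :=
  match z, w with
  | inl x, inl y => [set x; y] \in E
  | inl x, inr A => x \in A
  | inr A, inl x => x \in A
  | inr A, inr B => (A != B) && (A :&: B != set0)
  end.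

Definition mixed_dominating (S : {set T + {set T}}) : bool :=
  (S \subset elements) &&
  [forall z in elements :\: S, [exists w in S, adj_or_inc z w]].

Definition mixed_domination_number : nat :=
  #|[arg min_(S < elements | mixed_dominating S) #|S|]|.

Lemma mixed_dominating_elements : mixed_dominating elements.
Proof.
rewrite /mixed_dominating subxx /=; apply/forallP => z.
by rewrite setDv inE.
Qed.

Lemma mixed_domination_numberP k :
  mixed_domination_number = k <->
  (exists2 S, mixed_dominating S & #|S| = k) /\
  (forall S, mixed_dominating S -> k <= #|S|).
Proof.
rewrite /mixed_domination_number.
case: arg_minnP => [|S domS minS]; first exact: mixed_dominating_elements.
split=> [<-|[[S' domS' <-] minS']]; first by split=> //; exists S.
by apply/eqP; rewrite eqn_leq minS // minS'.
Qed.

End MixedDomination.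

Section GeneralizedPetersen.
Variables n k : nat.

Definition shift (j : nat) (i : 'I_n) : 'I_n :=
  Ordinal (ltn_pmod (i + j) (leq_ltn_trans (leq0n i) (ltn_ord i))).

Definition v (i : 'I_n) : 'I_n + 'I_n := inl i.
Definition u (i : 'I_n) : 'I_n + 'I_n := inr i.

(* Edge set of P(n,k), meaningful for 1 <= k <= n / 2. *)
Definition petersen : {set {set 'I_n + 'I_n}} :=
  [set [set v i; v (shift 1 i)] | i : 'I_n] :|:
  [set [set v i; u i] | i : 'I_n] :|:
  [set [set u i; u (shift k i)] | i : 'I_n].

Lemma shift_neq j (i : 'I_n) : 0 < j < n -> i != shift j i.
Proof.
case/andP=> j_gt0 j_ltn; rewrite -val_eqE /=; apply/eqP => eq_i.
have: i + 0 == i + j %[mod n] by rewrite addn0 -eq_i modn_small.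
by rewrite eqn_modDl mod0n modn_small // eq_sym eqn0Ngt j_gt0.
Qed.

Lemma petersen_simple : 1 <= k <= n./2 -> simple_edges petersen.
Proof.
case/andP=> k_gt0 k_le.
have k_ltn : k < n.
  have n_gt0 : 0 < n by case: (n) k_le k_gt0 => //; case: (k).
  by apply: leq_ltn_trans k_le _; rewrite ltn_half_double -addnn -[ltnLHS]addn0 ltn_add2l.
have n_gt1 : 1 < n by apply: leq_ltn_trans k_gt0 k_ltn.
move=> A; rewrite !inE -orbA => /or3P[] /imsetP[i _ ->]; rewrite cards2 //.
- by rewrite (inj_eq inl_inj) shift_neq.
- by rewrite (inj_eq inr_inj) shift_neq // k_gt0.
Qed.

End GeneralizedPetersen.

(* Main.v *)
Require Import Defs.
From mathcomp Require Import all_boot zify.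

Set Implicit Arguments.
Unset Strict Implicit.
Unset Printing Implicit Defensive.

(* P(n,1) is a prism, so a mixed dominating set is a cyclic word of n columns
   (two vertices, two outgoing rail edges and one rung each), and domination is
   a condition on three consecutive columns.  It is thus a closed walk of length
   n in a finite transfer automaton with 32 states, and the minimal weight of
   such walks is computed in the (min,+) semiring: for every start state the
   vector of minimal weights grows by at least 6 between steps 5 and 13, hence
   over every period of 8 from step 5 on, which reduces the lower bound to
   8 <= n < 16.  For the upper bound, optimal cyclic words of lengths 8, ..., 15
   sharing their first two columns are extended by copies of the word of
   length 8. *)

(** * The transfer automaton *)

(* [((x, a), (y, b), g)] tells which of v_i, v_i v_(i+1), u_i, u_i u_(i+1) and
   v_i u_i, in this order, are selected; below, the row is [true] for v and
   [false] for u. *)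
Definition column := ((bool * bool) * (bool * bool) * bool)%type.
Implicit Type c : column.

Definition row c (r : bool) := if r then c.1.1 else c.1.2.
Definition vbit c r := (row c r).1.
Definition ebit c r := (row c r).2.
Definition gbit c := c.2.

Definition weight c : nat := vbit c true + ebit c true + (vbit c false + ebit c false) + gbit c.

(* One row of a column whose predecessor is known: vertex selected, vertex
   dominated so far, rail selected, rail dominated so far. *)
Definition rstate := (bool * bool * bool * bool)%type.
Definition rpush (s : rstate) c r : rstate :=
  let: (x, _, a, _) := s in
  (vbit c r, [|| x, vbit c r, vbit c (~~ r), a, ebit c r | gbit c],
   ebit c r, [|| a, vbit c r, ebit c r | gbit c]).
Definition rok (s : rstate) c r :=
  let: (_, dx, a, da) := s in
  (dx || vbit c r) && [|| da, vbit c r, ebit c r | gbit c].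

Definition state := (rstate * rstate)%type.
Definition push (s : state) c : state := (rpush s.1 c true, rpush s.2 c false).
(** The vertices and rails of the last column read await only the next column [c]. A rung depends on
    its own column and the rails entering it, so the rung tested is that of [c]. *)
Definition ok (s : state) c :=
  [&& rok s.1 c true, rok s.2 c false
    & [|| gbit c, vbit c true, vbit c false, ebit c true, ebit c false,
          s.1.1.2 | s.2.1.2]].
Definition state0 : state := ((false, false, false, false), (false, false, false, false)).
(** [push] keeps only the vertex and rail bits of the old state, so two columns determine a state
    and the blank [state0] leaves no trace. *)
Definition window c1 c2 := push (push state0 c1) c2.

Definition bools := [:: true; false].
Definition columns : seq column :=
  [seq (p, g) | p <- [seq (p, q) | p <- [seq (x, a) | x <- bools, a <- bools],
                                   q <- [seq (y, b) | y <- bools, b <- bools]],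
                g <- bools].
Lemma mem_columns c : c \in columns.
Proof. by case: c => [[[[] []] [[] []]] []]. Qed.

Definition states : seq state := undup [seq window c d | c <- columns, d <- columns].
Lemma mem_states c d : window c d \in states.
Proof. by rewrite mem_undup; apply: allpairs_f; apply: mem_columns. Qed.

(** Incoming arcs, grouped by target so that a relaxation step is a fold over each list. *)
Definition arcs : seq (seq (nat * nat)) :=
  [seq [seq (index p.1 states, weight p.2) | p <- [seq (s, c) | s <- states, c <- columns]
         & ok p.1 p.2 && (push p.1 p.2 == t)] | t <- states].

(* The default [_ + 3] only serves states without predecessor; it amounts to a
   spurious loop of weight 3, harmless for a lower bound. *)
Definition relax (ar : seq (seq (nat * nat))) (V : seq nat) : seq nat :=
  mkseq (fun t => foldr (fun e m => minn (nth 0 V e.1 + e.2) m) (nth 0 V t + 3) (nth [::] ar t))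
    (size ar).

(* Starting elsewhere costs 15 instead of infinity, which is large enough for
   the minima over closed walks not to be affected. *)
Definition dist ar i0 j := iter j (relax ar) (mkseq (fun t => if t == i0 then 0 else 15) (size ar)).

Lemma foldr_minn_le (T : eqType) (f : T -> nat) m0 (l : seq T) x : x \in l ->
  foldr (fun e m => minn (f e) m) m0 l <= f x.
Proof.
elim: l => //= y l IH; rewrite inE => /orP[/eqP->|/IH h]; first exact: geq_minl.
exact: leq_trans (geq_minr _ _) h.
Qed.

Lemma relax_le V s c : s \in states -> push s c \in states -> ok s c ->
  nth 0 (relax arcs V) (index (push s c) states) <= nth 0 V (index s states) + weight c.
Proof.
move=> hs ht hok; rewrite nth_mkseq; last by rewrite size_map index_mem.
apply: (foldr_minn_le (fun e => nth 0 V e.1 + e.2) _ (x := (index s states, weight c))).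
rewrite (nth_map state0) ?index_mem // nth_index //.
apply/mapP; exists (s, c) => //.
by rewrite mem_filter hok eqxx allpairs_f // mem_columns.
Qed.

Definition gamma n :=
  6 * (n %/ 8) + match n %% 8 with
    | 0 => 0 | 1 | 2 => 2 | 3 => 3 | 4 | 5 => 4 | 6 => 5 | _ => 6 end.

(** Lengths 8 to 15 represent all residues modulo 8. The growth by 6 is tested from step 5 to step
    13 only and is later carried along the walk. *)
Definition dist_check ar N i0 :=
  let D0 := dist ar i0 0 in let D := traject (relax ar) D0 16 in
  let d j t := nth 0 (nth D0 D j) t in
  [&& d 0 i0 == 0, all (fun j => gamma j <= d j i0) (iota 8 8)
    & all (fun t => d 5 t + 6 <= d 13 t) (iota 0 N)].

Lemma dist_check_arcs : all (dist_check arcs (size states)) (iota 0 (size states)).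
Proof. by vm_compute. Qed.

Lemma dist_checkP ar N i0 : dist_check ar N i0 ->
  [/\ nth 0 (dist ar i0 0) i0 = 0,
      forall j, 8 <= j < 16 -> gamma j <= nth 0 (dist ar i0 j) i0
    & forall t, t < N -> nth 0 (dist ar i0 5) t + 6 <= nth 0 (dist ar i0 13) t].
Proof.
have nthD j : j < 16 ->
    nth (dist ar i0 0) (traject (relax ar) (dist ar i0 0) 16) j = dist ar i0 j.
  by move=> hj; rewrite nth_traject.
rewrite /dist_check !nthD // => /and3P[/eqP-> /allP h1 /allP h2].
split=> // [j /andP[j8 j16]|t ht].
  by rewrite -nthD //; apply: h1; rewrite mem_iota j8.
by apply: h2; rewrite mem_iota.
Qed.

(** Makes the computed vectors abstract: by the first two clauses, [d s0 j s] bounds from below the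
    weight of a walk of length [j] from [s0] to [s]. *)
Lemma walk_bound : exists d : state -> nat -> state -> nat,
  forall s0, s0 \in states ->
  [/\ d s0 0 s0 = 0,
      forall j s c, s \in states -> push s c \in states -> ok s c ->
        d s0 j.+1 (push s c) <= d s0 j s + weight c,
      forall j, 8 <= j < 16 -> gamma j <= d s0 j s0
    & forall s, s \in states -> d s0 5 s + 6 <= d s0 13 s].
Proof.
exists (fun s0 j s => nth 0 (dist arcs (index s0 states) j) (index s states)) => s0 hs0.
have idx_lt s : s \in states -> index s states < size states by rewrite index_mem.
have [|d0 d8 d5] := @dist_checkP arcs (size states) (index s0 states).
  by apply: (allP dist_check_arcs); rewrite mem_iota add0n idx_lt.
split=> // [j s c hs hps oks|s hs]; last exact: d5 (idx_lt _ hs).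
by rewrite /dist iterS; exact: relax_le.
Qed.

Lemma gammaD8 j q : gamma (j + 8 * q) = gamma j + 6 * q.
Proof.
by rewrite /gamma [8 * q]mulnC [j + _]addnC divnMDl // modnMDl mulnDr -addnA addnC.
Qed.

(** * Lower bound for closed walks *)

Section ClosedWalk.
Variable c : nat -> column.
Let s i := window (c i) (c i.+1).
Hypothesis ok_c : forall i, ok (s i) (c i.+2).
(** The start state [s 0] has already read [c 0] and [c 1], so counting begins at [c 2]. *)
Let W j := \sum_(i < j) weight (c i.+2).

Lemma gamma_le_weight n : 8 <= n -> c n = c 0 -> c n.+1 = c 1 -> gamma n <= W n.
Proof.
move=> hn c0 c1; have ins i : s i \in states by exact: mem_states.
have WS k : W k.+1 = W k + weight (c k.+2) by rewrite /W big_ord_recr.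
have [d /(_ (s 0) (ins 0))[]] := walk_bound; move: (d (s 0)) => {}d d0 dS d8 d5.
have step q k : d k (s (k + 8 * q)) + 6 * q <= W (k + 8 * q) ->
    d k.+1 (s (k.+1 + 8 * q)) + 6 * q <= W (k.+1 + 8 * q).
  move=> h; rewrite addSn WS; apply: leq_trans (leq_add h (leqnn _)).
  rewrite addnAC leq_add2r; set i := k + 8 * q.
  (* [push (s i) (c i.+2)] is convertible to [s i.+1]. *)
  exact: dS k (s i) (c i.+2) (ins i) (ins i.+1) (ok_c i).
have base k : d k (s k) <= W k.
  have: d k (s (k + 8 * 0)) + 6 * 0 <= W (k + 8 * 0).
    by elim: k => [|k]; [rewrite d0 | exact: step].
  by rewrite !muln0 !addn0.
(* Each period is absorbed by resetting the step count from 13 to 5 at a gain of 6; larger [j]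
   follow by [step]. *)
have main q : forall j, 5 <= j -> d j (s (j + 8 * q)) + 6 * q <= W (j + 8 * q).
  elim: q => [|q IH] j; first by rewrite !muln0 !addn0 base.
  elim: j => // j IHj; rewrite leq_eqVlt eqSS => /orP[/eqP<-|hj]; last by apply: step; exact: IHj.
  have -> : 5 + 8 * q.+1 = 13 + 8 * q by rewrite mulnS addnA.
  by apply: leq_trans (IH 13 isT); rewrite mulnS addnA leq_add2r d5.
(* This puts [j] in the range from 8 to 15, where the bound for returning to the start state was
   computed. *)
pose q := (n - 8) %/ 8; pose j := (n - 8) %% 8 + 8.
have En : n = j + 8 * q by rewrite /j addnAC mulnC [_ + q * _]addnC -divn_eq subnK.
have j8 : 8 <= j < 16 by rewrite /j leq_addl (ltn_add2r 8 _ 8) ltn_mod.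
have j5 : 5 <= j by case/andP: j8 => h _; exact: leq_trans h.
have := main q j j5; rewrite -En; apply: leq_trans.
by rewrite {1}En gammaD8 leq_add2r /s c0 c1 d8.
Qed.
End ClosedWalk.

(** * Optimal words *)

Fixpoint valid (w : seq column) : bool :=
  match w with
  | c1 :: ((c2 :: c3 :: _) as w') => ok (window c1 c2) c3 && valid w'
  | _ => true
  end.

Definition cO : column := ((false, false), (false, false), false).
Definition cV : column := ((true, false), (false, false), false).
Definition cU : column := ((false, false), (true, false), false).
Definition cA : column := ((false, true), (false, false), false).
Definition cB : column := ((false, false), (false, true), false).
Definition cG : column := ((false, false), (false, false), true).
Definition cAG : column := ((false, true), (false, false), true).
Definition cAU : column := ((false, true), (true, false), false).

Lemma valid_nth w i : valid w -> i.+2 < size w ->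
  ok (window (nth cO w i) (nth cO w i.+1)) (nth cO w i.+2).
Proof.
elim: w i => [|c1 [|c2 [|c3 w]] IH] [|i] //= /andP[h1 h2] hi //.
exact: IH.
Qed.

(** Validity concerns three consecutive columns, so words can be glued along an overlap of two. *)
Lemma valid_cat w c1 c2 w' : valid (w ++ [:: c1; c2]) -> valid (c1 :: c2 :: w') ->
  valid (w ++ c1 :: c2 :: w').
Proof.
elim: w => [|d1 [|d2 [|d3 w]] IH] //= /andP[-> h1] h2 //; exact: IH.
Qed.

Definition block := [:: cO; cU; cA; cB; cO; cV; cB; cA].
(** Each [head r] has length [8 + r] and weight [gamma (8 + r)], and begins with [cO] and [cU] as
    [block] does. *)
Definition head r := match r with
  | 0 => block
  | 1 => [:: cO; cU; cA; cB; cO; cV; cG; cG; cAG]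
  | 2 => [:: cO; cU; cA; cB; cO; cV; cB; cA; cO; cAU]
  | 3 => block ++ [:: cO; cU; cAG]
  | 4 => block ++ [:: cO; cU; cG; cAG]
  | 5 => block ++ [:: cO; cU; cV; cB; cA]
  | 6 => block ++ [:: cO; cU; cG; cV; cB; cA]
  | _ => block ++ [:: cO; cU; cA; cB; cO; cV; cAG]
  end.

Definition word n := head (n %% 8) ++ flatten (nseq (n %/ 8).-1 block).

(** Repeating the first two columns at the end makes linear validity express cyclic validity. *)
Lemma valid_word n : valid (word n ++ [:: cO; cU]).
Proof.
rewrite /word -catA; set F := flatten _ ++ _.
have [w EF vF] : exists2 w, F = [:: cO, cU & w] & valid F.
  rewrite /F; elim: _.-1 => [|q [w /= -> v]]; first by exists [::].
  by exists (drop 2 block ++ [:: cO, cU & w]) => //=.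
rewrite EF; apply: valid_cat; last by rewrite -EF.
by case: (n %% 8) => [|[|[|[|[|[|[|r]]]]]]].
Qed.

Lemma size_weight_word n : 8 <= n ->
  size (word n) = n /\ sumn (map weight (word n)) = gamma n.
Proof.
move=> hn; rewrite /word map_cat size_cat sumn_cat; set q := _.-1; set r := n %% 8.
have En : n = 8 + r + 8 * q.
  by rewrite addnAC -mulnS prednK ?divn_gt0 // mulnC -divn_eq.
have [-> ->] : size (flatten (nseq q block)) = 8 * q /\
    sumn (map weight (flatten (nseq q block))) = 6 * q.
  by elim: {En} q => // q [IHs IHw]; rewrite /= IHs IHw !mulnS.
rewrite [in gamma n]En gammaD8 [in _ = n]En.
have : r < 8 by rewrite ltn_mod.
by case: {En} r => [|[|[|[|[|[|[|[|r]]]]]]]].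
Qed.

Lemma cyclic_walk n : 8 <= n -> exists c : nat -> column,
  [/\ forall i, c (i %% n) = c i,
      forall i, ok (window (c i) (c i.+1)) (c i.+2)
    & \sum_(i < n) weight (c i) = gamma n].
Proof.
move=> hn; have [size_w weight_w] := size_weight_word hn.
have n0 : 0 < n by exact: leq_trans hn.
exists (fun i => nth cO (word n) (i %% n)); split=> [i|i|]; first by rewrite modn_mod.
  pose w := word n ++ [:: cO; cU].
  have wE j : j < n.+2 -> nth cO w j = nth cO (word n) (j %% n).
    have w01 : nth cO (word n) 0 = cO /\ nth cO (word n) 1 = cU.
      by rewrite /word; case: (n %% 8) => [|[|[|[|[|[|[|r]]]]]]].
    rewrite !ltnS leq_eqVlt ltnS leq_eqVlt nth_cat size_w.
    case/or3P=> [/eqP->|/eqP->|hj]; last by rewrite hj modn_small.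
      by rewrite ltnNge leqnSn subSnn -addn1 modnDl modn_small //; [case: w01 | lia].
    by rewrite ltnn subnn modnn; case: w01.
  (* A window starting below [n] overruns the word by at most two columns, which [w] supplies. *)
  have shiftE k : k < 3 -> nth cO (word n) ((k + i) %% n) = nth cO w (k + i %% n).
    move=> hk; rewrite -modnDmr -wE // -[n.+2]addn2.
    by have := ltn_pmod i n0; lia.
  have := valid_nth (valid_word n) (i := i %% n).
  rewrite -/w (shiftE 0) // (shiftE 1) // (shiftE 2) //; apply.
  by rewrite size_cat size_w addn2 !ltnS ltn_mod.
rewrite -weight_w sumnE big_map (big_nth cO) size_w big_mkord.
by apply: eq_bigr => i _; rewrite modn_small.
Qed.

(** * Prisms as cyclic words *)

(** The automaton condition unfolded: the vertices of [c2], the rails of [c2] and the rung of [c3]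
    are selected or dominated. *)
Lemma ok_windowP c1 c2 c3 :
  ok (window c1 c2) c3 <->
  [/\ forall r, [|| vbit c1 r, vbit c2 r, vbit c2 (~~ r), ebit c1 r, ebit c2 r, gbit c2
                  | vbit c3 r],
      forall r, [|| ebit c1 r, vbit c2 r, ebit c2 r, gbit c2, vbit c3 r, ebit c3 r | gbit c3]
    & [|| gbit c3, vbit c3 true, vbit c3 false, ebit c3 true, ebit c3 false, ebit c2 true
        | ebit c2 false]].
Proof.
rewrite /ok /rok /= -!orbA; split=> [/and3P[/andP[v1 e1] /andP[v2 e2] g]|[v e g]].
  by split=> // -[].
by have := (v true, v false, e true, e false) => /= -[[[-> ->] -> ->]].
Qed.

Section Prism.
Variable n : nat.
Hypothesis n_gt2 : 2 < n.
Let n_gt0 : 0 < n. Proof. exact: leq_trans n_gt2. Qed.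
Implicit Types (i j : 'I_n) (r : bool).

Definition vtx r i : 'I_n + 'I_n := if r then v i else u i.
Definition rail r i := [set vtx r i; vtx r (shift 1 i)].
Definition rung i := [set v i; u i].
Let E := petersen n 1.

Definition ordmod k : 'I_n := Ordinal (ltn_pmod k n_gt0).

Lemma shift_ordmod d k : shift d (ordmod k) = ordmod (k + d).
Proof. by apply: val_inj; rewrite /= modnDml. Qed.

Lemma ordmod_surj i d : exists k, i = ordmod (k + d).
Proof.
(* Adding [d * n.-1] subtracts [d] modulo [n]. *)
exists (i + d * n.-1); apply: val_inj; rewrite /= -addnA -mulnSr prednK //.
by rewrite addnC modnMDl modn_small.
Qed.

Lemma shift_inj d : injective (@shift n d).
Proof.
move=> i j /(congr1 val) /eqP /=; rewrite eqn_modDr !modn_small // => /eqP h.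
exact: val_inj.
Qed.

Lemma eq_vtx r i r' j : (vtx r i == vtx r' j) = (r == r') && (i == j).
Proof. by case: r r' => [] []. Qed.

Lemma vtxP (x : 'I_n + 'I_n) : exists r i, x = vtx r i.
Proof. by case: x => i; [exists true | exists false]; exists i. Qed.

Lemma in_rail r i r' j : (vtx r i \in rail r' j) = (r == r') && ((i == j) || (i == shift 1 j)).
Proof. by rewrite !inE !eq_vtx andb_orr. Qed.

Lemma rungE r i : rung i = [set vtx r i; vtx (~~ r) i].
Proof. by case: r => //; rewrite setUC. Qed.

Lemma in_rung r i j : (vtx r i \in rung j) = (i == j).
Proof. by rewrite (rungE r) !inE !eq_vtx eqxx; case: r; rewrite /= orbF. Qed.

Lemma petersen_rail r i : rail r i \in E.
Proof. by rewrite !inE; case: r; rewrite imset_f ?orbT. Qed.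

Lemma petersen_rung i : rung i \in E.
Proof. by rewrite !inE imset_f ?orbT. Qed.

Lemma petersenP A : A \in E -> (exists r i, A = rail r i) \/ (exists i, A = rung i).
Proof.
rewrite !inE => /orP[/orP[]|] /imsetP[i _ ->].
- by left; exists true, i.
- by right; exists i.
- by left; exists false, i.
Qed.

(** * Domination read off three consecutive columns *)

Section Domination.
Variable S : {set ('I_n + 'I_n) + {set 'I_n + 'I_n}}.
Let V r i := inl (vtx r i) \in S.
Let R r i := inr (rail r i) \in S.
Let G i := inr (rung i) \in S.

Definition column_of i : column := ((V true i, R true i), (V false i, R false i), G i).

Lemma vbit_column_of i r : vbit (column_of i) r = V r i. Proof. by case: r. Qed.
Lemma ebit_column_of i r : ebit (column_of i) r = R r i. Proof. by case: r. Qed.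

(** A vertex lies on two rails and one rung only; injectivity of the shift identifies the rail that
    ends there. *)
Lemma edge_at A r i : S \subset elements E -> inr A \in S -> vtx r (shift 1 i) \in A ->
  [|| R r i, R r (shift 1 i) | G (shift 1 i)].
Proof.
move=> /subsetP/(_ (inr A)) sub SA; move: (SA) => /sub; rewrite inE.
case/petersenP=> [[r' [j EA]]|[j EA]]; subst A; rewrite ?in_rail ?in_rung.
  case/andP=> /eqP-> /orP[/eqP->|/eqP/shift_inj->]; rewrite /R SA ?orbT //.
by move/eqP->; rewrite /G SA !orbT.
Qed.

Lemma dominating_ok i : mixed_dominating E S ->
  ok (window (column_of i) (column_of (shift 1 i))) (column_of (shift 1 (shift 1 i))).
Proof.
case/andP=> sub /forallP dom; have {dom} domP z : z \in elements E -> z \notin S ->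
    exists2 w, w \in S & adj_or_inc E z w.
  move=> Ez Sz; have := dom z; rewrite inE Ez Sz /=.
  by case/existsP=> w /andP[]; exists w.
have edge_near A r j : inr A \in S -> vtx r (shift 1 j) \in A ->
  [|| R r j, R r (shift 1 j) | G (shift 1 j)] by exact: edge_at.
set i1 := shift 1 i; set i2 := shift 1 i1.
apply/ok_windowP; split=> [r|r|]; rewrite !vbit_column_of !ebit_column_of.
- case SV: (V r i1); first by rewrite !orbT.
  have [|x Sx] := domP (inl (vtx r i1)) _ (negbT SV); first by rewrite inE.
  case: x Sx => [x|A] Sx /=; last by move/(edge_near _ _ _ Sx)/or3P=> [] ->; rewrite !orbT.
  (* [B] joins the two vertices. As a rail it places [j] in one of the three columns, as a rung in
     [i1]; the degenerate case of equal vertices contradicts [SV]. *)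
  have [r' [j Ex]] := vtxP x; subst x; set B := [set _; _] => EB.
  have [B1 B2] : vtx r i1 \in B /\ vtx r' j \in B by rewrite !inE !eqxx orbT.
  case/petersenP: EB B1 B2 => [[r0 [k ->]]|[k ->]]; rewrite ?in_rail ?in_rung.
    case/andP=> /eqP<- hk /andP[/eqP Er hj]; subst r'.
    have : [|| j == i, j == i1 | j == i2].
      by case/orP: hk => [/eqP Ek|/eqP/shift_inj Ek]; subst k; case/orP: hj => ->; rewrite ?orbT.
    by case/or3P=> /eqP Ej; subst j; move: Sx; rewrite -/(V _ _) ?SV // => ->; rewrite ?orbT.
  move=> /eqP<- /eqP Ej; subst j; move: Sx; rewrite -/(V _ _).
  by case: (eqVneq r' r) => [->|]; [rewrite SV | case: r' r {SV B} => [] [] // _ ->; rewrite !orbT].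
- case SR: (R r i1); first by rewrite !orbT.
  have [|x Sx] := domP (inr (rail r i1)) _ (negbT SR); first by rewrite inE petersen_rail.
  case: x Sx => [x|A] Sx /=.
    have [r' [j Ex]] := vtxP x; subst x; rewrite in_rail => /andP[/eqP Er]; subst r'.
    by case/orP=> /eqP Ej; subst j; move: Sx; rewrite -/(V _ _) => ->; rewrite !orbT.
  (* The shared endpoint is either end of the rail, in column [i1] or [i2]. *)
  case/andP=> _ /set0Pn[x]; have [r' [j ->]] := vtxP x; rewrite inE in_rail.
  case/andP=> /andP[/eqP-> /orP[]/eqP->] /(edge_near _ _ _ Sx) /or3P[];
    rewrite ?SR // => ->; rewrite ?orbT //.
- case SG: (G i2); first by rewrite /gbit /= SG.
  have [|x Sx] := domP (inr (rung i2)) _ (negbT SG); first by rewrite inE petersen_rung.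
  case: x Sx => [x|A] Sx /=.
    have [r' [j Ex]] := vtxP x; subst x; rewrite in_rung => /eqP Ej; subst j.
    by move: Sx; rewrite -/(V _ _); case: r' => ->; rewrite !orbT.
  case/andP=> _ /set0Pn[x]; have [r' [j ->]] := vtxP x; rewrite inE in_rung.
  by case/andP=> /eqP-> /(edge_near _ _ _ Sx) /or3P[]; rewrite ?SG //; case: r' => ->; rewrite ?orbT.
Qed.

Lemma ok_dominating : S \subset elements E ->
  (forall i, ok (window (column_of i) (column_of (shift 1 i))) (column_of (shift 1 (shift 1 i)))) ->
  mixed_dominating E S.
Proof.
move=> sub okS; rewrite /mixed_dominating sub /=; apply/forallP=> z; apply/implyP.
rewrite in_setD => /andP[Sz Ez].
suff [w Sw adj] : exists2 w, w \in S & adj_or_inc E z w.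
  by apply/existsP; exists w; rewrite Sw.
(* Vertices and rails must be moved to the middle of a window, hence one step back; rungs to its
   end, hence two. *)
have prev j : exists i, j = shift 1 i.
  have [k ->] := ordmod_surj j 1; by exists (ordmod k); rewrite shift_ordmod.
(* The two edges differ because [B] is selected and [A] is not. *)
have edges r i A B : z = inr A -> inr B \in S -> vtx r i \in A -> vtx r i \in B ->
    exists2 w, w \in S & adj_or_inc E z w.
  move=> Ez' SB hA hB; exists (inr B) => //; rewrite Ez' /=; apply/andP; split.
    by apply: contraNneq Sz => AB; rewrite Ez' AB.
  by apply/set0Pn; exists (vtx r i); rewrite inE hA.
case: z Sz Ez edges => [x|A] Sz; last rewrite inE => /petersenP[[r [j EA]]|[j EA]].
- move=> _ _; have [r [j Ex]] := vtxP x; have [i Ej] := prev j; subst x j.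
  have /ok_windowP[/(_ r) + _ _] := okS i.
  rewrite !vbit_column_of !ebit_column_of /gbit /= /V /R /G.
  rewrite (negbTE Sz) /=; case/or4P=> [h|h|h|/or3P[h|h|h]].
  + by exists (inl (vtx r i)) => //=; rewrite setUC petersen_rail.
  + by exists (inl (vtx (~~ r) (shift 1 i))) => //=; rewrite -rungE petersen_rung.
  + by exists (inr (rail r i)) => //=; rewrite in_rail !eqxx orbT.
  + by exists (inr (rail r (shift 1 i))) => //=; rewrite in_rail !eqxx.
  + by exists (inr (rung (shift 1 i))) => //=; rewrite in_rung.
  + by exists (inl (vtx r (shift 1 (shift 1 i)))) => //=; rewrite petersen_rail.
- move=> edges; have [i Ej] := prev j; subst A j.
  have /ok_windowP[_ /(_ r) + _] := okS i.
  rewrite !vbit_column_of !ebit_column_of /gbit /= /V /R /G.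
  rewrite (negbTE Sz) /=; case/or4P=> [h|h|h|/or3P[h|h|h]].
  + by apply: (edges r (shift 1 i) _ _ erefl h); rewrite in_rail !eqxx ?orbT.
  + by exists (inl (vtx r (shift 1 i))) => //=; rewrite in_rail !eqxx.
  + by apply: (edges r (shift 1 i) _ _ erefl h); rewrite ?in_rung ?in_rail !eqxx ?orbT.
  + by exists (inl (vtx r (shift 1 (shift 1 i)))) => //=; rewrite in_rail !eqxx orbT.
  + by apply: (edges r (shift 1 (shift 1 i)) _ _ erefl h); rewrite in_rail !eqxx ?orbT.
  + by apply: (edges r (shift 1 (shift 1 i)) _ _ erefl h); rewrite ?in_rung ?in_rail !eqxx ?orbT.
- move=> edges; have [j' Ej] := prev j; have [i Ej'] := prev j'; subst A j j'.
  have /ok_windowP[_ _] := okS i.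
  rewrite /vbit /ebit /gbit /= /V /R /G.
  rewrite (negbTE Sz) /=; set j := shift 1 (shift 1 i); case/or4P=> [h|h|h|/or3P[h|h|h]].
  + by exists (inl (vtx true j)) => //=; rewrite (in_rung true).
  + by exists (inl (vtx false j)) => //=; rewrite (in_rung false).
  + by apply: (edges true j _ _ erefl h); rewrite ?in_rung ?in_rail !eqxx ?orbT.
  + by apply: (edges false j _ _ erefl h); rewrite ?in_rung ?in_rail !eqxx ?orbT.
  + by apply: (edges true j _ _ erefl h); rewrite ?in_rung ?in_rail !eqxx ?orbT.
  + by apply: (edges false j _ _ erefl h); rewrite ?in_rung ?in_rail !eqxx ?orbT.
Qed.
End Domination.

(** * Weight of a word and size of a set *)

(** The five elements of a column form a finite type, so that the total weight of a word becomes a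
    cardinality. *)
Definition kind := (bool * bool + unit)%type.

Definition item (p : 'I_n * kind) : ('I_n + 'I_n) + {set 'I_n + 'I_n} :=
  match p.2 with
  | inl (r, true) => inl (vtx r p.1)
  | inl (r, false) => inr (rail r p.1)
  | inr _ => inr (rung p.1)
  end.

Definition kbit (c : column) (k : kind) :=
  match k with
  | inl (r, true) => vbit c r
  | inl (r, false) => ebit c r
  | inr _ => gbit c
  end.

Lemma weightE (c : column) : weight c = \sum_k kbit c k.
Proof.
have -> : \sum_k kbit c k = \sum_r \sum_b kbit c (inl (r, b)) + kbit c (inr tt).
  rewrite big_sumType /= pair_bigA (big_pred1 tt); last by case.
  by congr (_ + _); apply: eq_bigr => -[].
by rewrite !big_bool.
Qed.

Lemma sum_weight (c : 'I_n -> column) :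
  \sum_i weight (c i) = #|[set p : 'I_n * kind | kbit (c p.1) p.2]|.
Proof.
rewrite -sum1_card [RHS]big_mkcond; under eq_bigr do rewrite weightE.
rewrite pair_bigA; apply: eq_bigr => p _; rewrite inE.
by case: (kbit _ _).
Qed.

Lemma kbit_column_of S i k : kbit (column_of S i) k = (item (i, k) \in S).
Proof. by case: k => [[[] []]|[]]. Qed.

Lemma item_inj : injective item.
Proof.
have neq_shift i : (shift 1 i == i) = false.
  by apply/negbTE; rewrite eq_sym shift_neq //; lia.
have vtx_inj r i r' j : vtx r i = vtx r' j -> r = r' /\ i = j.
  by move/eqP; rewrite eq_vtx => /andP[/eqP-> /eqP->].
have rail_rung r i j : rail r i != rung j.
  apply/eqP=> /setP h.
  have := h (vtx r (shift 1 i)); have := h (vtx r i).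
  by rewrite !in_rail !in_rung !eqxx /= orbT => /esym/eqP<-; rewrite neq_shift.
have rail_inj r i r' j : rail r i = rail r' j -> r = r' /\ i = j.
  move=> /setP h; have := h (vtx r i); have := h (vtx r (shift 1 i)).
  rewrite !in_rail !eqxx orbT /= => /esym/andP[/eqP-> h1] /esym/andP[_ h2].
  split=> //; case/orP: h2 => /eqP // Ei; subst i; case/orP: h1 => /eqP.
    (* Two rails with exchanged ends would give [j + 2 = j] modulo [n], which [n > 2] excludes. *)
    move/(congr1 val) => /=; rewrite modnDml -addnA => /eqP.
    rewrite -{2}[j : nat](modn_small (ltn_ord j)) -{2}[j : nat]addn0 eqn_modDl.
    by rewrite mod0n modn_small //; lia.
  by move/shift_inj/eqP; rewrite neq_shift.
have rung_inj i j : rung i = rung j -> i = j.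
  by move/setP/(_ (vtx true i)); rewrite !in_rung eqxx => /esym/eqP.
move=> [i [[r []]|[]]] [j [[r' []]|[]]] //= [].
- by case/vtx_inj=> -> ->.
- by case/rail_inj=> -> ->.
- by move/eqP; rewrite (negbTE (rail_rung _ _ _)).
- by move/eqP; rewrite eq_sym (negbTE (rail_rung _ _ _)).
- by move/rung_inj->.
Qed.

Lemma sum_weight_le S : \sum_i weight (column_of S i) <= #|S|.
Proof.
rewrite sum_weight -(card_imset _ item_inj); apply: subset_leq_card.
by apply/subsetP=> _ /imsetP[[i k] + ->]; rewrite inE kbit_column_of.
Qed.

Lemma columns_set (c : 'I_n -> column) : exists S : {set _},
  [/\ S \subset elements E, #|S| = \sum_i weight (c i) & forall i, column_of S i = c i].
Proof.
exists (item @: [set p | kbit (c p.1) p.2]); split.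
- apply/subsetP=> _ /imsetP[[i [[r []]|[]]] _ ->]; rewrite inE //=.
    exact: petersen_rail.
  exact: petersen_rung.
- by rewrite sum_weight (card_imset _ item_inj).
- move=> i; set S := _ @: _.
  have kE k : kbit (column_of S i) k = kbit (c i) k.
    by rewrite kbit_column_of (mem_imset _ _ item_inj) inE.
  have := (kE (inl (true, true)), kE (inl (true, false)), kE (inl (false, true)),
    kE (inl (false, false)), kE (inr tt)).
  case: (column_of S i) (c i) => [[[? ?] [? ?]] ?] [[[? ?] [? ?]] ?].
  by rewrite /kbit /vbit /ebit /gbit /= => -[[[[-> ->] ->] ->] ->].
Qed.

Lemma mixed_domination_prism : 8 <= n -> mixed_domination_number E = gamma n.
Proof.
move=> n8; apply/mixed_domination_numberP; split=> [|S domS].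
  have [c [c_mod c_ok c_sum]] := cyclic_walk n8.
  have [S [sub cardS colS]] := columns_set (fun i => c i).
  exists S; last by rewrite cardS.
  apply: ok_dominating => // i; rewrite !colS /=.
  by rewrite c_mod modnDml c_mod -addnA addn1 addn2.
pose c k := column_of S (ordmod k).
have shiftE k : shift 1 (ordmod k) = ordmod k.+1 by rewrite shift_ordmod addn1.
have cn k : c (k + n) = c k.
  by congr column_of; apply: val_inj; rewrite /= modnDr.
have := @gamma_le_weight c _ n n8 (cn 0) (cn 1).
move=> /(_ _)/leq_trans; apply=> [k|].
  by have := dominating_ok (ordmod k) domS; rewrite !shiftE.
apply: leq_trans (sum_weight_le S).
(* The walk weighs columns 2 to [n + 1], so the sum over all columns is rotated by two to match. *)
rewrite [leqRHS](reindex_inj (@shift_inj 2)) leq_eqVlt; apply/orP; left; apply/eqP.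
apply: eq_bigr => i _; congr (weight (column_of _ _)); apply: val_inj => /=.
by rewrite addn2.
Qed.
End Prism.

Theorem theorem1 (n : nat) (hn : 8 <= n) :
  let m := n %/ 8 in
  let r := n %% 8 in
  mixed_domination_number (petersen n 1) =
    match r with
    | 0 => 6 * m
    | 1 | 2 => 6 * m + 2
    | 3 => 6 * m + 3
    | 4 | 5 => 6 * m + 4
    | 6 => 6 * m + 5
    | _ => 6 * m + 6
    end.
Proof.
move=> m r; rewrite mixed_domination_prism //; last exact: leq_trans hn.
rewrite /gamma -/m -/r.
by case: r => [|[|[|[|[|[|[|r]]]]]]]; rewrite ?addn0.
Qed.
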